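(* If the Exponential Time Hypothesis holds, then there exists $k>0$ such that $NDTIME(\lceil k\log_2 n\rceil,\ n)\not\subseteq DTIME(n)$.
   Context: The Exponential Time Hypothesis (ETH): there is a constant $c>0$ such that 3SAT on instances with $\ell$ variables cannot be solved by a deterministic algorithm in $2^{c\ell}\mathrm{poly}(\ell)$ time. $NDTIME(f(n),g(n))$ denotes the class of problems solvable in $O(g(n))$ time by a multi-tape Turing machine using an $f(n)$-bit non-deterministic oracle; $DTIME(g(n))=NDTIME(0,g(n))$. *)

(* Defs.v *)
From HB Require Import structures.
From mathcomp Require Import all_boot all_order all_algebra.
From mathcomp Require Import classical_sets reals exp.

Set Implicit Arguments.
Unset Strict Implicit.
Unset Printing Implicit Defensive.

Import Order.TTheory GRing.Theory Num.Theory.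

Local Open Scope ring_scope.

Inductive move := MoveL | MoveN | MoveR.

(* A two-way infinite tape, blank outside the stored cells. The symbols to the
   left of the head are listed from the head outwards. *)
Record tape (S : Type) := Tape { tleft : seq S; thead : S; tright : seq S }.

Definition tape_of (S : Type) (blank : S) (w : seq S) : tape S :=
  Tape [::] (head blank w) (behead w).

Definition write_move (S : Type) (blank : S) (a : S * move) (t : tape S) :
    tape S :=
  match a.2 with
  | MoveN => Tape (tleft t) a.1 (tright t)
  | MoveL =>
      Tape (behead (tleft t)) (head blank (tleft t)) (a.1 :: tright t)
  | MoveR =>
      Tape (a.1 :: tleft t) (head blank (tright t)) (behead (tright t))
  end.

(* Multi-tape Turing machines with an oracle supplying nondeterministic bits.
   A step from a [query] state consumes one oracle bit, which is passed to
   [delta]; a step from any other state passes [None] and is deterministic.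
   [verdict q] is [Some b] when [q] is a halting state, accepting iff [b]. *)
Record machine := Machine {
  ntapes : nat;
  state : finType;
  symbol : finType;
  blank : symbol;
  bit : bool -> symbol;
  bit_inj : injective bit;
  bit_neq_blank : forall b, bit b != blank;
  start : state;
  verdict : state -> option bool;
  query : pred state;
  delta : state -> option bool -> {ffun 'I_ntapes.+1 -> symbol} ->
          state * {ffun 'I_ntapes.+1 -> symbol * move}
}.

Record config (M : machine) := Config {
  cstate : state M;
  ctapes : 'I_(ntapes M).+1 -> tape (symbol M);
  cused : nat  (* number of oracle bits consumed so far *)
}.

Definition init (M : machine) (x : seq bool) : config M :=
  Config (start M)
    (fun i => tape_of (blank M) (if i == ord0 then map (@bit M) x else [::]))
    0%N.

(* The oracle [o] answers the [j]-th query with [o j]. Halting configurations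
   are left unchanged. *)
Definition step (M : machine) (o : nat -> bool) (c : config M) : config M :=
  let q := cstate c in
  if verdict q is Some _ then c else
  let r := delta q (if query q then Some (o (cused c)) else None)
                 [ffun i => thead (ctapes c i)] in
  Config r.1 (fun i => write_move (blank M) (r.2 i) (ctapes c i))
         (query q + cused c)%N.

Definition run (M : machine) (o : nat -> bool) (x : seq bool) (t : nat) :
    config M :=
  iter t (@step M o) (init M x).

Definition halts_within (M : machine) (x : seq bool) (b t : nat) : Prop :=
  forall o, verdict (cstate (run M o x t)) /\ (cused (run M o x t) <= b)%N.

Definition accepts_within (M : machine) (x : seq bool) (t : nat) : Prop :=
  exists o, verdict (cstate (run M o x t)) = Some true.

Definition is_bigO (T g : nat -> nat) : Prop :=
  exists C N : nat, forall n : nat, (N <= n)%N -> (T n <= C * g n)%N.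

(* [f] only bounds the number of bits requested on every computation path; the
   machine is not told the value of [f (size x)], so even an uncomputable [f]
   gives it no information. *)
Definition NDTIME (f g : nat -> nat) : set (set (seq bool)) :=
  [set L | exists (M : machine) (T : nat -> nat), is_bigO T g /\
     forall x : seq bool,
       halts_within M x (f (size x)) (T (size x)) /\
       (L x <-> accepts_within M x (T (size x)))].

Definition DTIME (g : nat -> nat) : set (set (seq bool)) :=
  NDTIME (fun=> 0%N) g.

(* [(true, v)] is the literal v and [(false, v)] its negation. *)
Definition literal (l : nat) := (bool * 'I_l)%type.
Definition clause3 (l : nat) := (3.-tuple (literal l))%type.
Definition cnf3 (l : nat) := seq (clause3 l).

Definition satisfiable (l : nat) (phi : cnf3 l) : Prop :=
  exists a : 'I_l -> bool,
    forall c, c \in phi -> exists2 y : literal l, y \in c & a y.2 = y.1.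

Definition encode_literal (l : nat) (y : literal l) : seq bool :=
  y.1 :: rcons (nseq y.2 true) false.

(* Indices are written in unary, so a duplicate-free formula on l variables has
   an encoding of length polynomial in l. *)
Definition encode_cnf3 (l : nat) (phi : cnf3 l) : seq bool :=
  rcons (nseq l true) false ++
  flatten [seq flatten [seq encode_literal y | y <- val c] | c <- phi].

(* Clauses may not be repeated in an instance: otherwise the instances on l
   variables would have unbounded length, no bound in terms of l alone could be
   met, and ETH would hold trivially. *)
Definition solves_3SAT_in_time (R : realType) (M : machine) (T : nat -> R) :
    Prop :=
  forall (l : nat) (phi : cnf3 l), uniq phi ->
    exists t : nat,
      [/\ t%:R <= T l,
          halts_within M (encode_cnf3 phi) 0%N t &
          satisfiable phi <-> accepts_within M (encode_cnf3 phi) t].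

Definition ETH (R : realType) : Prop :=
  exists2 c : R, 0 < c &
    ~ exists (M : machine) (p : {poly R}),
        solves_3SAT_in_time M (fun l => 2 `^ (c * l%:R) * p.[l%:R]).

(* The value at n = 0 is 0, because [ln 0 = 0]. *)
Definition ceil_klog2 (R : realType) (k : R) (n : nat) : nat :=
  `|Num.ceil (k * (ln n%:R / ln 2))|%N.

(* Main.v *)
(** Contrapositive, for [c > 0] and an integer [d >= 1 / c].  Inputs have the
    form [1^j 0 w] with [w] a list of clauses.  A machine that reads the prefix
    in rounds of lengths 1, 2, 4, ... and requests [d] bits after each round
    obtains [d * floor (log2 j)] bits in linear time, and then evaluates [w] on
    them, again in linear time; so its language lies in NDTIME with
    [k = d].  If this language were in DTIME(n), 3SAT on [l] variables could be
    solved by first stretching the prefix [1^l] of the encoding to a length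
    of order [2 ^ (l / d)], so that the bits suffice for a whole assignment,
    and then running the linear-time machine. *)
From HB Require Import structures.
Require Import Defs.
From mathcomp Require Import all_boot all_order all_algebra.
From mathcomp Require Import boolp classical_sets reals exp.
From mathcomp Require Import zify lra.

Set Implicit Arguments.
Unset Strict Implicit.
Unset Printing Implicit Defensive.

(* [tuple.thead] would otherwise shadow the projection of [tape]. *)
Local Notation thead := Defs.thead.

(** * Tapes and runs *)

Section Stacks.
Variables (S : Type) (blank : S).
Implicit Types (t : tape S) (l r : seq S) (a : S).

(* The part of a tape left of the head, read as a stack with its top next to the
   head ([above_stack]) or under it ([on_stack]). Blanks at the far end may or
   may not be stored, hence the existential quantifiers. *)
Definition on_stack t l := exists z, thead t :: tleft t = l ++ nseq z blank.
Definition above_stack t l := exists z, tleft t = l ++ nseq z blank.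
Definition left_of_word t r := exists z, tright t = r ++ nseq z blank.
Definition on_word t r := exists z, thead t :: tright t = r ++ nseq z blank.

Lemma on_stack_nil t : on_stack t [::] -> thead t = blank.
Proof. by case=> -[|z] //= []. Qed.

Lemma on_stack_cons t a l : on_stack t (a :: l) -> thead t = a.
Proof. by case=> z []. Qed.

Lemma on_stack_push a t l :
  above_stack t l -> on_stack (write_move blank (a, MoveN) t) (a :: l).
Proof. by case=> z tl; rewrite /on_stack /= tl; exists z. Qed.

Lemma above_stack_push a t l :
  above_stack t l -> above_stack (write_move blank (a, MoveR) t) (a :: l).
Proof. by case=> z tl; rewrite /above_stack /= tl; exists z. Qed.

Lemma above_stack_turn t :
  on_stack t [::] -> above_stack (write_move blank (blank, MoveR) t) [::].
Proof. by case=> -[|z] //= [_ tl]; exists z.+1; rewrite /= tl. Qed.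

Lemma on_stack_turn a t l :
  above_stack t l -> on_stack (write_move blank (a, MoveL) t) l.
Proof.
case: l => [|b l] [z] tl; rewrite /on_stack /= tl; last by exists z.
by case: z {tl} => [|z]; [exists 1 | exists z.+1].
Qed.

Lemma above_stack_behead t a l : on_stack t (a :: l) -> above_stack t l.
Proof. by case=> z [_ tl]; rewrite /above_stack tl; exists z. Qed.

Lemma on_stack_pop b t a l :
  on_stack t (a :: l) -> on_stack (write_move blank (b, MoveL) t) l.
Proof. by move=> /above_stack_behead; exact: on_stack_turn. Qed.

Lemma on_word_move a t r :
  left_of_word t r -> on_word (write_move blank (a, MoveR) t) r.
Proof.
case: r => [|b r] [z] tl; rewrite /on_word /= tl; last by exists z.
by case: z {tl} => [|z]; [exists 1 | exists z.+1].
Qed.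

Lemma left_of_word_move a t r :
  left_of_word t r -> left_of_word (write_move blank (a, MoveL) t) (a :: r).
Proof. by case=> z tl; rewrite /left_of_word /= tl; exists z. Qed.

Lemma on_wordE t (r : seq S) :
  on_word t r -> thead t = head blank r /\ left_of_word t (behead r).
Proof.
by case: r => [[[|z] //= [-> tr]]|a r [z /= [-> tr]]]; split=> //; exists z.
Qed.

Lemma write_head t : write_move blank (thead t, MoveN) t = t.
Proof. by case: t. Qed.

End Stacks.

(** * Tape layout shared by the two machines *)

Section FourTapes.
Variables (S : Type) (n : nat).

(** The first [n.+1] tapes belong to a simulated machine, whose input tape is also the main tape;
    two counters and one extra tape follow. The guessing machine simulates nothing and takes
    [n = 0]. *)
Definition main_tape : 'I_(n + 3).+1 := ord0.
Definition counter (b : bool) : 'I_(n + 3).+1 := rshift n.+1 (inord b).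
Definition own_tape (i : 'I_n.+1) : 'I_(n + 3).+1 := lshift 3 i.
Definition extra_tape : 'I_(n + 3).+1 := rshift n.+1 ord_max.

Definition act (f : 'I_(n + 3).+1 -> S) (b : bool)
    (a0 aA aB aX : S * move) : {ffun 'I_(n + 3).+1 -> S * move} :=
  [ffun i => if i == main_tape then a0 else if i == counter b then aA else
     if i == counter (~~ b) then aB else if i == extra_tape then aX else
     (f i, MoveN)].

Lemma counter_neq_main b : (counter b == main_tape) = false.
Proof. by rewrite -val_eqE. Qed.

Lemma act_main f b a0 aA aB aX : act f b a0 aA aB aX main_tape = a0.
Proof. by rewrite ffunE eqxx. Qed.

Lemma act_counter f b a0 aA aB aX : act f b a0 aA aB aX (counter b) = aA.
Proof. by rewrite ffunE counter_neq_main eqxx. Qed.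

Lemma act_counterN f b a0 aA aB aX : act f b a0 aA aB aX (counter (~~ b)) = aB.
Proof.
rewrite ffunE counter_neq_main eqxx.
by rewrite -val_eqE /= !inordK ?eqn_add2l; case: b.
Qed.

Lemma act_counter_true f a0 aA aB aX :
  act f false a0 aA aB aX (counter true) = aB.
Proof. exact: (act_counterN f false). Qed.

Lemma act_extra f b a0 aA aB aX : act f b a0 aA aB aX extra_tape = aX.
Proof.
rewrite ffunE eqxx -!val_eqE /= !inordK ?eqn_add2l; by case: b.
Qed.

Lemma act_other f b a0 aA aB aX (i : 'I_n.+1) : i != ord0 ->
  act f b a0 aA aB aX (own_tape i) = (f (own_tape i), MoveN).
Proof.
rewrite -val_eqE /= ffunE -!val_eqE /= => /negbTE->.
by rewrite !ltn_eqF // ltn_addr.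
Qed.

Definition actE :=
  (act_main, act_counter, act_counterN, act_counter_true, act_extra).

End FourTapes.

Section Runs.
Variables (M : machine) (o : nat -> bool).

Lemma halted_iter (c : config M) t :
  verdict (cstate c) -> iter t (step o) c = c.
Proof.
move=> hc; elim: t => //= t ->; rewrite /step /=.
by case: (verdict _) hc.
Qed.

Lemma halted_leq (c : config M) t1 t2 : t1 <= t2 ->
  verdict (cstate (iter t1 (step o) c)) ->
  iter t2 (step o) c = iter t1 (step o) c.
Proof. by move=> le_t h1; rewrite -(subnK le_t) iterD halted_iter. Qed.

(* [I k c]: the invariant holds in [c] and at most [k] steps remain. *)
Lemma reach (I : nat -> config M -> Prop) (D : config M -> Prop) :
  (forall k c, I k c -> D c \/ exists2 k', k' < k & I k' (step o c)) ->
  forall k c, I k c -> exists2 t, t <= k & D (iter t (step o) c).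
Proof.
move=> IS k; elim/ltn_ind: k => k IH c /IS[Dc|[k' lt_k' /IH]].
  by exists 0.
by case=> // t le_t Dt; exists t.+1; [exact: leq_ltn_trans lt_k'|rewrite iterSr].
Qed.

End Runs.

(** * The machine with [d * log n] nondeterministic bits *)

(** One-pass evaluation, in the form a machine can follow: [k] is the position in the clause, [ok]
    records an earlier true literal of it, and [cur] holds the sign and the part of the unary index
    already read. *)
Fixpoint check (g : nat -> bool) (k : nat) (ok : bool)
    (cur : option (bool * nat)) (w : seq bool) : bool :=
  match w, cur with
  | [::], _ => ~~ cur
  | b :: w', None => check g k ok (Some (b, 0)) w'
  | true :: w', Some (b, v) => check g k ok (Some (b, v.+1)) w'
  | false :: w', Some (b, v) =>
      let ok' := ok || (g v == b) in
      if k == 2 then ok' && check g 0 false None w'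
      else check g k.+1 ok' None w'
  end.

Definition encode_clauses (l : nat) (phi : cnf3 l) : seq bool :=
  flatten [seq flatten [seq encode_literal y | y <- val c] | c <- phi].

Lemma check_literal g k ok l (y : literal l) w :
  check g k ok None (encode_literal y ++ w) =
  let ok' := ok || (g y.2 == y.1) in
  if k == 2 then ok' && check g 0 false None w else check g k.+1 ok' None w.
Proof.
case: y => b [v _] /=; rewrite cat_rcons if_same.
suff H : forall m v', check g k ok (Some (b, v')) (nseq m true ++ false :: w) =
  check g k ok (Some (b, v' + m)) (false :: w) by rewrite H.
by elim=> [|m IH] v'; rewrite ?addn0 //= IH addSnnS.
Qed.

Lemma check_clauses g l (phi : cnf3 l) :
  check g 0 false None (encode_clauses phi) =
  all (fun c : clause3 l => has (fun y : literal l => g y.2 == y.1) c) phi.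
Proof.
have := fun k ok => @check_literal g k ok l.
(* Abstracting [encode_literal] lets simplification split clauses into literals without unfolding
   the literals. *)
rewrite /encode_clauses; move: (@encode_literal l) => enc checkE.
elim: phi => //= c phi <-.
case: c => -[|y1 [|y2 [|y3 [|]]]] //= _.
by rewrite cats0 -!catA !checkE /= orbF orbA.
Qed.

(** Bit [v] is the value of variable [v]; bits from [l] on are never looked up. *)
Lemma satisfiableP l (phi : cnf3 l) N : l <= N ->
  satisfiable phi <->
  exists o : nat -> bool,
    check (nth false (mkseq o N)) 0 false None (encode_clauses phi).
Proof.
move=> leN; split=> [[a sat_a]|[o]]; last first.
  rewrite check_clauses => /allP sat_o; exists (fun v => o v) => c /sat_o/hasP.
  by case=> y yc /eqP; rewrite nth_mkseq ?(leq_trans (ltn_ord _)) //; exists y.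
exists (fun v => if insub v is Some i then a i else false).
rewrite check_clauses; apply/allP => c /sat_a[y yc ay]; apply/hasP.
exists y; rewrite // nth_mkseq ?(leq_trans (ltn_ord _)) //.
rewrite (insubT (fun v => v < l) (ltn_ord y.2)) /= -ay.
by apply/eqP; congr a; exact: val_inj.
Qed.

Section Guesser.
Variable d : nat.

(* The boolean of [Count], [Double] and [Guess] says which counter tape is
   being emptied. [Guess b i] has [i] bits left to request. In [Rewind k ok],
   [Sign k ok] and [Index k ok b], [k] is the position in the current clause
   and [ok] tells whether one of its previous literals is true. *)
Inductive gstate :=
  | Skip
  | Count of bool
  | Double of bool
  | Guess of bool & 'I_d.+1
  | Rewind of 'I_3 & bool
  | Sign of 'I_3 & bool
  | Index of 'I_3 & bool & bool
  | Halt of bool.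

Definition gstate_code (q : gstate) : unit + bool + bool + bool * 'I_d.+1 +
    'I_3 * bool + 'I_3 * bool + 'I_3 * bool * bool + bool :=
  match q with
  | Skip => inl (inl (inl (inl (inl (inl (inl tt))))))
  | Count b => inl (inl (inl (inl (inl (inl (inr b))))))
  | Double b => inl (inl (inl (inl (inl (inr b)))))
  | Guess b i => inl (inl (inl (inl (inr (b, i)))))
  | Rewind k ok => inl (inl (inl (inr (k, ok))))
  | Sign k ok => inl (inl (inr (k, ok)))
  | Index k ok b => inl (inr (k, ok, b))
  | Halt b => inr b
  end.

Definition gstate_decode q : gstate :=
  match q with
  | inl (inl (inl (inl (inl (inl (inl tt)))))) => Skip
  | inl (inl (inl (inl (inl (inl (inr b)))))) => Count b
  | inl (inl (inl (inl (inl (inr b))))) => Double b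
  | inl (inl (inl (inl (inr (b, i))))) => Guess b i
  | inl (inl (inl (inr (k, ok)))) => Rewind k ok
  | inl (inl (inr (k, ok))) => Sign k ok
  | inl (inr (k, ok, b)) => Index k ok b
  | inr b => Halt b
  end.

Lemma gstate_codeK : cancel gstate_code gstate_decode.
Proof. by case. Qed.

HB.instance Definition _ := Finite.copy gstate (can_type gstate_codeK).

(** Each one read takes a unit from counter [b] and puts two into the other. A one read when counter
    [b] is empty adds a single unit, ends the round and exchanges the counters, so contents 2^r - 1
    become 2^(r+1) - 1 and round lengths double. After the zero, each literal is evaluated by
    rewinding the extra tape and walking along it in step with the unary index. *)
Definition gdelta (q : gstate) (ob : option bool)
    (f : {ffun 'I_(0 + 3).+1 -> option bool}) :
    gstate * {ffun 'I_(0 + 3).+1 -> option bool * move} :=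
  let h := f (main_tape 0) in
  let hX := f (extra_tape 0) in
  let stay i := (f i, MoveN) in
  let next q' b a0 aA aB aX := (q', act f b a0 aA aB aX) in
  let still q' := next q' false (h, MoveN) (stay (counter 0 false))
                    (stay (counter 0 true)) (hX, MoveN) in
  match q with
  | Skip =>
      if h == Some true then
        next (Count false) false (h, MoveR) (stay (counter 0 false))
          (stay (counter 0 true)) (hX, MoveN)
      else still (Halt false)
  | Count b =>
      match h with
      | Some true =>
          if f (counter 0 b) == None then
            next (Guess (~~ b) ord_max) b
              (h, MoveR) (None, MoveR) (Some true, MoveN) (hX, MoveN)
          else
            next (Double b) b
              (h, MoveR) (None, MoveL) (Some true, MoveR) (hX, MoveN)
      | Some false =>
          next (Rewind ord0 false) false (h, MoveR) (stay (counter 0 false))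
            (stay (counter 0 true)) (hX, MoveL)
      | None => still (Halt false)
      end
  | Double b =>
      next (Count b) b
        (h, MoveN) (stay (counter 0 b)) (Some true, MoveR) (hX, MoveN)
  | Guess b i =>
      if i == ord0 then still (Count b)
      else next (Guess b (inord i.-1)) b (h, MoveN) (stay (counter 0 b))
             (stay (counter 0 (~~ b))) (ob, MoveR)
  | Rewind k ok =>
      if hX == None then still (Sign k ok)
      else next (Rewind k ok) false (h, MoveN) (stay (counter 0 false))
             (stay (counter 0 true)) (hX, MoveL)
  | Sign k ok =>
      if h is Some b then
        next (Index k ok b) false (h, MoveR) (stay (counter 0 false))
          (stay (counter 0 true)) (hX, MoveR)
      else still (Halt true)
  | Index k ok b =>
      (* Cells beyond the guessed bits are filled with [false], so that the
         used part of the tape stays contiguous. *)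
      let g := odflt false hX in
      let go q' m := next q' false (h, MoveR) (stay (counter 0 false))
                       (stay (counter 0 true)) (Some g, m) in
      match h with
      | Some true => go (Index k ok b) MoveR
      | Some false =>
          let ok' := ok || (g == b) in
          go (if k == 2 :> nat then
                if ok' then Rewind ord0 false else Halt false
              else Rewind (inord k.+1) ok') MoveN
      | None => still (Halt false)
      end
  | Halt b => still (Halt b)
  end.

Lemma Some_neq_None (b : bool) : Some b != None. Proof. by []. Qed.

Definition guesser : machine :=
  @Machine (0 + 3) gstate (option bool) None Some Some_inj Some_neq_None Skip
    (fun q => if q is Halt b then Some b else None)
    (fun q => if q is Guess _ i then i != ord0 else false)
    gdelta.

End Guesser.

(** * Linear running time of the guessing machine *)

Section GuesserTime.
Variable d : nat.

Definition unread (t : tape (option bool)) :=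
  size (tright t) + (thead t != None).
Definition leftward (t : tape (option bool)) :=
  size (tleft t) + (thead t != None).

Lemma unread_moveR a t : thead t != None ->
  unread (write_move None (a, MoveR) t) < unread t.
Proof.
by case: t => l [b|] [|[c|] r] //= _; rewrite /unread /= ?addn0 addn1 ltnS.
Qed.

Lemma leftward_moveL a t : thead t != None ->
  leftward (write_move None (a, MoveL) t) < leftward t.
Proof.
by case: t => [[|[c|] l] [b|] r] //= _; rewrite /leftward /= ?addn0 addn1 ltnS.
Qed.

Lemma leftward_moveL_le a t :
  leftward (write_move None (a, MoveL) t) <= leftward t.
Proof. by case: t => [[|[c|] l] [b|] r] //=; rewrite /leftward /=; lia. Qed.

(** One unit is for the cell left behind, one for a nonblank new head cell. *)
Lemma leftward_moveR_le a t :
  leftward (write_move None (a, MoveR) t) <= leftward t + 2.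
Proof. by case: t => [l [b|] [|[c|] r]] //=; rewrite /leftward /=; lia. Qed.

Lemma leftward_moveN_le a t :
  leftward (write_move None (a, MoveN) t) <= leftward t + 1.
Proof.
by case: t => [l [b|] r] //=; rewrite /leftward /=; case: (a != None); lia.
Qed.

Definition gweight (q : gstate d) : nat :=
  match q with
  | Halt _ => 0
  | Double _ | Rewind _ _ => 2
  | Guess _ i => 3 * i + 2
  | _ => 1
  end.

(** An amortised potential. Each input cell passed releases [3 * d + 5] units, enough for [d]
    requests at three units each: one for the step and two for the growth of [leftward]. Rewinding
    is paid by [leftward] itself, that is, by earlier moves to the right. *)
Definition gmeasure (c : config (guesser d)) : nat :=
  (3 * d + 5) * unread (ctapes c (main_tape 0)) +
  leftward (ctapes c (extra_tape 0)) + gweight (cstate c).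

Lemma unread_drop (K u u' : nat) : u' < u -> K * u' + K <= K * u.
Proof. by move=> lt_u; rewrite -mulnSr leq_mul2l lt_u orbT. Qed.

Lemma gmeasure_step o (c : config (guesser d)) :
  ~~ verdict (cstate c) -> gmeasure (step o c) < gmeasure c.
Proof.
case: c => q T u; rewrite /gmeasure /step.
move: q T; rewrite /guesser /= => q T.
have fE i : [ffun i => thead (T i)] i = thead (T i) by rewrite ffunE.
move: [ffun i => thead (T i)] fE => f fE.
have drop a b : thead (T (main_tape 0)) = Some b ->
    (3 * d + 5) * unread (write_move None (a, MoveR) (T (main_tape 0))) +
    (3 * d + 5) <= (3 * d + 5) * unread (T (main_tape 0)).
  by move=> h0; apply/unread_drop/unread_moveR; rewrite h0.
case: q => [|b|b|b i|k ok|k ok|k ok b|b] //= _; rewrite ?fE.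
- by case: eqP => [/(drop (thead (T (main_tape 0))))|_] /=;
    rewrite !actE !write_head; lia.
- case h0: (thead (T (main_tape 0))) => [[]|] /=.
  + have {}drop := drop (Some true) true h0.
    by case: ifP => _; rewrite /= !actE write_head /=; lia.
  + have := drop (Some false) false h0; rewrite /= !actE => {}drop.
    have := leftward_moveL_le (thead (T (extra_tape 0))) (T (extra_tape 0)).
    by lia.
  + by rewrite !actE -h0 !write_head; lia.
- by rewrite !actE !write_head; lia.
- case: eqP => [_|/eqP i0] /=; rewrite !actE !write_head; first by lia.
  have := leftward_moveR_le (Some (o u)) (T (extra_tape 0)).
  have i_gt0 : 0 < i by rewrite lt0n.
  have lt_i := ltn_ord i.
  by rewrite inordK; lia.
- case: eqP => [_|/eqP hX] /=; rewrite !actE !write_head; first by lia.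
  by rewrite ltn_add2r ltn_add2l; exact: leftward_moveL.
- case h0: (thead (T (main_tape 0))) => [b|] /=; last first.
    by rewrite !actE -h0 !write_head; lia.
  have := drop (Some b) _ h0; rewrite /= !actE => {}drop.
  have := leftward_moveR_le (thead (T (extra_tape 0))) (T (extra_tape 0)).
  by lia.
- case h0: (thead (T (main_tape 0))) => [[]|] /=; last first.
  + by rewrite !actE -h0 !write_head; lia.
  + have := drop (Some false) false h0; rewrite /= !actE => {}drop.
    have := leftward_moveN_le (Some (odflt false (thead (T (extra_tape 0)))))
      (T (extra_tape 0)).
    by case: ifP => _; [case: ifP => _|]; rewrite /=; lia.
  + have := drop (Some true) true h0; rewrite /= !actE => {}drop.
    have := leftward_moveR_le (Some (odflt false (thead (T (extra_tape 0)))))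
      (T (extra_tape 0)).
    by lia.
Qed.

End GuesserTime.

Lemma guesser_halts d o x :
  verdict (cstate (run (guesser d) o x ((3 * d + 5) * size x + 1))).
Proof.
have [k c /eqP <-|t le_t halt_t] := @reach (guesser d) o
  (fun k c => gmeasure c == k) (fun c => verdict (cstate c)) _
  _ (init (guesser d) x) (eqxx _).
  case hc: (isSome (verdict (cstate c))); [by left | right].
  by exists (gmeasure (step o c)); rewrite // gmeasure_step ?hc.
rewrite /run (halted_leq _ halt_t) //; apply: leq_trans le_t _.
rewrite /gmeasure /leftward /unread /=.
by case: x {halt_t} => [|b x] /=; rewrite ?size_map; lia.
Qed.

(** * Correctness of the guessing machine *)

Lemma unary_prefix_inj j j' w w' :
  nseq j true ++ false :: w = nseq j' true ++ false :: w' -> j = j' /\ w = w'.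
Proof. by elim: j j' => [|j IH] [|j'] //= []; [move=> ->|move/IH=> [-> ->]]. Qed.

Lemma on_word_cons (t : tape (option bool)) b (w : seq bool) :
  Defs.thead t = Some b -> on_word None t (map Some w) ->
  exists w', w = b :: w' /\
    forall a, on_word None (write_move None (a, MoveR) t) (map Some w').
Proof.
move=> ht wt; have [] := on_wordE wt; rewrite ht {wt}.
case: w => //= c w [->] tr.
by exists w; split=> // a; exact: on_word_move.
Qed.

Lemma on_word_nil (t : tape (option bool)) (w : seq bool) :
  Defs.thead t = None -> on_word None t (map Some w) -> w = [::].
Proof. by move=> ht wt; have [] := on_wordE wt; rewrite ht; case: w {wt}. Qed.

(** Filling a blank cell with [false] is invisible to [nth false]. *)
Lemma nth_rcons_head (l r : seq bool) i :
  nth false (rcons l (head false r) ++ behead r) i = nth false (l ++ r) i.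
Proof.
case: r => [|b r] /=; last by rewrite cat_rcons.
by rewrite !cats0 nth_rcons if_same; case: ltnP => // /(nth_default false)->.
Qed.

Lemma cat_nseqS (b : bool) j w : nseq j b ++ b :: w = nseq j.+1 b ++ w.
Proof. by elim: j => //= j ->. Qed.

Section GuesserInvariant.
Variables (d : nat) (x : seq bool) (o : nat -> bool).

Definition answer (j : nat) (w : seq bool) : bool :=
  check (nth false (mkseq o (d * trunc_log 2 j))) 0 false None w.

(** Evaluating the unread part [w] from the present state gives the answer for the whole clause
    list. The extra tape, [l ++ r], agrees with the guesses only under [nth false], since cells
    holding [false] may have been appended. *)
Definition verifying (k : nat) ok cur (t0 : tape (option bool)) u l r :=
  exists j w0 w, [/\ x = nseq j true ++ false :: w0, 0 < j,
    u = d * trunc_log 2 j, on_word None t0 (map Some w) &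
    check (nth false (mkseq o u)) k ok cur w = answer j w0 /\
    forall i, nth false (l ++ r) i = nth false (mkseq o u) i].

(* [r] rounds are over and the current round, of length [2 ^ r], ends once
   [s + 1] more ones are read. *)
Definition counting (v : nat) (t0 tA tB tX : tape (option bool)) u :=
  exists j w s v' r, [/\ x = nseq j true ++ w, on_word None t0 (map Some w),
    on_stack None tA (nseq s (Some true)),
    above_stack None tB (nseq v' (Some true)) &
    [/\ tX = Tape (rev (map Some (mkseq o u))) None [::],
        j + s + 1 = 2 ^ r.+1, v' + v + 2 * s + 2 = 2 ^ r.+1 & u = d * r]].

(** At [Halt] the bound on the bits covers every input, as [NDTIME] demands, while the verdict is
    described for well-formed prefixes only. *)
Definition ginv (q : gstate d) (T : 'I_(0 + 3).+1 -> tape (option bool))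
    (u : nat) : Prop :=
  let t0 := T (main_tape 0) in
  let tX := T (extra_tape 0) in
  match q with
  | Skip =>
      [/\ on_word None t0 (map Some x), on_stack None (T (counter 0 false)) [::],
          above_stack None (T (counter 0 true)) [::],
          tX = Tape [::] None [::] & u = 0]
  | Count b => counting 0 t0 (T (counter 0 b)) (T (counter 0 (~~ b))) tX u
  | Double b => counting 1 t0 (T (counter 0 b)) (T (counter 0 (~~ b))) tX u
  | Guess b i => exists w r, [/\ x = nseq (2 ^ r) true ++ w,
      on_word None t0 (map Some w),
      on_stack None (T (counter 0 b)) (nseq (2 ^ r).-1 (Some true)),
      above_stack None (T (counter 0 (~~ b))) [::] &
      tX = Tape (rev (map Some (mkseq o u))) None [::] /\ u + i = d * r]
  | Rewind k ok => exists l r, [/\ verifying k ok None t0 u l r,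
      on_stack None tX (map Some (rev l)) & left_of_word None tX (map Some r)]
  | Sign k ok => exists r, [/\ verifying k ok None t0 u [::] r,
      on_stack None tX [::] & left_of_word None tX (map Some r)]
  | Index k ok b => exists l r, [/\ verifying k ok (Some (b, size l)) t0 u l r,
      above_stack None tX (map Some (rev l)) & on_word None tX (map Some r)]
  | Halt b => u <= d * trunc_log 2 (size x) /\
      forall j w, 0 < j -> x = nseq j true ++ false :: w -> b = answer j w
  end.

(** By [unary_prefix_inj], the splitting of [x] in the invariant is the only one. *)
Lemma verifying_halt b k ok cur t0 u l r :
  (forall j w0 w, on_word None t0 (map Some w) ->
     check (nth false (mkseq o u)) k ok cur w = answer j w0 -> b = answer j w0) ->
  verifying k ok cur t0 u l r ->
  u <= d * trunc_log 2 (size x) /\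
  forall j w, 0 < j -> x = nseq j true ++ false :: w -> b = answer j w.
Proof.
move=> hb [j [w0 [w [xE j_gt0 uE wordw [cE _]]]]]; split.
  by rewrite uE leq_mul2l leq_trunc_log ?orbT // xE size_cat size_nseq leq_addr.
by move=> j' w0' _; rewrite xE => /unary_prefix_inj[<- <-]; exact: hb cE.
Qed.

Lemma ginv_init : ginv (Skip d) (ctapes (init (guesser d) x)) 0.
Proof.
rewrite /ginv /=; split=> //; try by [exists 1|exists 0].
by case: x => [|b y]; [exists 1|exists 0]; rewrite /= ?cats0.
Qed.

Lemma ginv_step (c : config (guesser d)) : ~~ verdict (cstate c) ->
  ginv (cstate c) (ctapes c) (cused c) ->
  ginv (cstate (step o c)) (ctapes (step o c)) (cused (step o c)).
Proof.
case: c => q T u; rewrite /step.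
move: q T; rewrite /guesser /= => q T.
have fE i : [ffun i => thead (T i)] i = thead (T i) by rewrite ffunE.
move: [ffun i => thead (T i)] fE => f fE.
case: q => [|b|b|b i|k ok|k ok|k ok b|b] //= _; rewrite ?fE.
- case=> w0 sA sB tX ->; case: eqP => [h0|h0] /=.
    have [w [xE w1]] := on_word_cons h0 w0.
    rewrite /counting !actE !write_head tX.
    (* The one read by [Skip] precedes all rounds: [j = 1 = 2 ^ 0], with both counters empty. *)
    by exists 1, w, 0, 0, 0; split=> //; split=> //; rewrite muln0.
  split=> // j w j_gt0 xE; case: h0; have [-> _] := on_wordE w0.
  by rewrite xE; case: j j_gt0 {xE}.
- case=> j [w [s [v [r [xE w0 sA sB [tX jE vE uE]]]]]].
  case h0: (thead (T (main_tape 0))) => [[]|] /=.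
  + have [w' [wE w1]] := on_word_cons h0 w0.
    case: eqP => hA /=.
      case: s sA jE vE => [|s] sA jE vE; last by rewrite (on_stack_cons sA) in hA.
      (* This one ends the round: [j.+1 = 2 ^ r.+1], and the other counter reaches
         [2 ^ r.+1 - 1]. *)
      exists w', r.+1; rewrite negbK !actE !write_head add0n; split=> //.
      * by rewrite xE wE cat_nseqS; congr (nseq _ _ ++ _); lia.
      * have -> : (2 ^ r.+1).-1 = v.+1 by lia.
        exact: on_stack_push.
      * exact: above_stack_turn.
      * by split=> //=; rewrite uE; lia.
    case: s sA jE vE => [|s] sA jE vE; first by rewrite (on_stack_nil sA) in hA.
    exists j.+1, w', s, v.+1, r; rewrite !actE !write_head add0n; split=> //.
    * by rewrite xE wE cat_nseqS.
    * exact: on_stack_pop sA.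
    * exact: above_stack_push.
    * by split=> //; lia.
  + have [w' [wE w1]] := on_word_cons h0 w0.
    have r_gt0 : 0 < 2 ^ r by rewrite expn_gt0.
    (* [jE] gives [j < 2 ^ r.+1]; [vE] gives [s < 2 ^ r], hence [2 ^ r <= j]. *)
    have tE : trunc_log 2 j = r.
      by apply: trunc_log_eq => //; rewrite expnS in jE vE *; lia.
    exists (mkseq o u), [::]; rewrite !actE tX; split=> //=.
    * exists j, w', w'; rewrite add0n; split=> //.
      - by rewrite xE wE.
      - by rewrite expnS in jE vE; lia.
      - by rewrite tE.
      - by rewrite /answer tE -uE; split=> // i; rewrite cats0.
    * by apply: on_stack_turn; exists 0; rewrite /= cats0 map_rev.
    * by exists 1.
  (* The input consists of ones only, so the claim on the verdict is vacuous. *)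
  + rewrite add0n; split=> [|j' w']; last first.
      rewrite xE (on_word_nil h0 w0) cats0 => _ /(congr1 (all id)).
      by rewrite all_nseq all_cat /= andbF orbT.
    rewrite uE leq_mul2l trunc_log_max ?orbT // xE size_cat size_nseq.
    by rewrite expnS in jE vE; lia.
- case=> j [w [s [v [r [xE w0 sA sB [tX jE vE uE]]]]]].
  exists j, w, s, v.+1, r; rewrite !actE !write_head; split=> //.
  + exact: above_stack_push.
  + by split=> //; lia.
- case=> w [r [xE w0 sA sB [tX uE]]]; case: eqP => [i0|/eqP i0] /=.
    exists (2 ^ r), w, (2 ^ r).-1, 0, r.
    have r_gt0 : 0 < 2 ^ r by rewrite expn_gt0.
    rewrite !actE !write_head; split=> //.
    * by case: b sA {sB}; rewrite !actE write_head.
    * by case: b sB {sA}; rewrite !actE write_head.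
    * by rewrite expnS; split=> //; move: uE; rewrite i0 /=; lia.
  exists w, r; rewrite !actE !write_head tX; split=> //.
  have lt_i := ltn_ord i; have i_gt0 : 0 < i by rewrite lt0n.
  rewrite inordK; last by lia.
  rewrite -[rev (_ :: _)]/(rev (map Some (mkseq o u.+1))).
  by rewrite mkseqS map_rcons rev_rcons; split=> //; lia.
- case=> l [r [[j [w0 [w [xE j_gt0 uE wt [cE gE]]]]] sX rX]].
  case: eqP => [hX|hX] /=.
    (* All cells of [l] hold bits, so a blank under the head means that [l] is empty. *)
    case: (lastP l) sX gE => [|l' b]; last first.
      by rewrite rev_rcons => sX; have := on_stack_cons sX; rewrite hX.
    move=> sX gE; exists r; rewrite !actE !write_head; split=> //.
    by exists j, w0, w; rewrite add0n.
  case: (lastP l) sX gE => [sX|l' b]; first by case: hX; exact: on_stack_nil sX.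
  rewrite rev_rcons /= => sX gE; exists l', (b :: r).
  rewrite !actE !write_head (on_stack_cons sX) add0n; split=> //=.
  + by exists j, w0, w; split=> //; split=> // i; rewrite -cat_rcons.
  + exact: on_stack_pop sX.
  + exact: left_of_word_move.
- case=> r [ver sX rX].
  case h0: (thead (T (main_tape 0))) => [b|] /=; last first.
    apply: verifying_halt ver => j w0 w wt.
    by rewrite (on_word_nil h0 wt) => <-.
  have [j [w0 [w [xE j_gt0 uE wt [cE gE]]]]] := ver.
  have [w' [wE w1]] := on_word_cons h0 wt.
  exists [::], r; rewrite !actE (on_stack_nil sX) add0n; split=> //=.
  + exists j, w0, w'; split=> //; split=> //.
    by move: cE; rewrite wE /= if_same.
  + exact: above_stack_turn.
  + exact: on_word_move.
- case=> l [r [ver sX rX]].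
  have [hX rX'] := on_wordE rX; rewrite behead_map in rX'.
  have {}hX : odflt false (thead (T (extra_tape 0))) = head false r.
    by rewrite hX; case: (r).
  rewrite hX.
  case h0: (thead (T (main_tape 0))) => [h|] /=; last first.
    apply: verifying_halt ver => j w0 w wt.
    by rewrite (on_word_nil h0 wt) => <-.
  have [j [w0 [w [xE j_gt0 uE wt [cE gE]]]]] := ver.
  have [w' [wE w1]] := on_word_cons h0 wt.
  have gE' i : nth false (rcons l (head false r) ++ behead r) i =
    nth false (mkseq o u) i by rewrite nth_rcons_head.
  have gl : nth false (mkseq o u) (size l) = head false r.
    by rewrite -gE nth_cat ltnn subnn nth0.
  have sX' : above_stack None (write_move None (Some (head false r), MoveR)
      (T (extra_tape 0))) (map Some (rev (rcons l (head false r)))).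
    by rewrite rev_rcons; exact: above_stack_push.
  have sXN : on_stack None (write_move None (Some (head false r), MoveN)
      (T (extra_tape 0))) (map Some (rev (rcons l (head false r)))).
    by rewrite rev_rcons; exact: on_stack_push.
  case: h h0 wE => h0 wE; rewrite wE /= in cE.
    exists (rcons l (head false r)), (behead r).
    rewrite !actE add0n size_rcons; split=> //.
    + by exists j, w0, w'.
    + exact: on_word_move.
  rewrite gl in cE; case: ifP cE => k2 cE /=; last first.
    exists (rcons l (head false r)), (behead r).
    rewrite !actE add0n; split=> //.
    exists j, w0, w'; split=> //; rewrite inordK //.
    by have := ltn_ord k; rewrite ltnS ltn_neqAle; lia.
  case: ifP cE => okE cE /=.
    exists (rcons l (head false r)), (behead r).
    rewrite !actE add0n; split=> //.
    by exists j, w0, w'.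
  (* The clause ends without a true literal, so [check] is false whatever follows. *)
  apply: verifying_halt ver => ? ? ? wt'.
  by have [? [-> _]] := on_word_cons h0 wt'; rewrite /= gl k2 okE.
Qed.


Lemma guesser_run : exists b,
  [/\ verdict (cstate (run (guesser d) o x ((3 * d + 5) * size x + 1))) = Some b,
      cused (run (guesser d) o x ((3 * d + 5) * size x + 1))
        <= d * trunc_log 2 (size x) &
      forall j w, 0 < j -> x = nseq j true ++ false :: w -> b = answer j w].
Proof.
have := guesser_halts d o x; set t := (_ + 1).
have : ginv (cstate (run (guesser d) o x t)) (ctapes (run (guesser d) o x t))
    (cused (run (guesser d) o x t)).
  elim: t => [|t IH]; first exact: ginv_init.
  rewrite /run iterS -/(run _ o x t).
  case ht: (isSome (verdict (cstate (run (guesser d) o x t)))).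
    by rewrite -[step o _]/(iter 1 (step o) _) halted_iter.
  by apply: ginv_step => //; rewrite ht.
case: (run _ _ _ _) => -[] //= b T u [le_u bE] _; exists b; split=> //.
Qed.

End GuesserInvariant.

(** * Stretching the unary prefix *)

Section Padder.
Variables (e : nat) (M : machine).

(* [Scan i]: the next mark is put on the extra tape after [i] more ones, so that
   it finally carries [l / e.+1] marks, rounded up. Each of them is then traded
   for one round more, where a round empties counter [b] and leaves twice as
   much plus one in the other counter; every step of the emptying extends the
   prefix by a one. *)
Inductive pstate :=
  | Scan of 'I_e.+1
  | Return
  | Fill of bool
  | Refill of bool.

Definition pstate_code (q : pstate) : 'I_e.+1 + unit + bool + bool :=
  match q with
  | Scan i => inl (inl (inl i))
  | Return => inl (inl (inr tt))
  | Fill b => inl (inr b)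
  | Refill b => inr b
  end.

Definition pstate_decode q : pstate :=
  match q with
  | inl (inl (inl i)) => Scan i
  | inl (inl (inr tt)) => Return
  | inl (inr b) => Fill b
  | inr b => Refill b
  end.

Lemma pstate_codeK : cancel pstate_code pstate_decode.
Proof. by case. Qed.

HB.instance Definition _ := Finite.copy pstate (can_type pstate_codeK).

Local Notation n := (ntapes M).
Local Notation one := (@bit M true).

(** The new ones go to the left of the input, so nothing is shifted. The last one is written without
    moving, which leaves the head on the first cell of the stretched input when [M] starts. *)
Definition pdelta (q : pstate + state M) (ob : option bool)
    (f : {ffun 'I_(n + 3).+1 -> symbol M}) :
    (pstate + state M) * {ffun 'I_(n + 3).+1 -> symbol M * move} :=
  let h := f (main_tape n) in
  let hX := f (extra_tape n) in
  let stay i := (f i, MoveN) in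
  let next q' b a0 aA aB aX := (q', act f b a0 aA aB aX) in
  match q with
  | inl (Scan i) =>
      if h == one then
        next (inl (Scan (if i == ord0 then ord_max else inord i.-1))) false
          (h, MoveR) (stay (counter n false)) (stay (counter n true))
          (if i == ord0 then (one, MoveR) else (hX, MoveN))
      else
        next (inl Return) false (h, MoveL)
          (stay (counter n false)) (stay (counter n true)) (hX, MoveL)
  | inl Return =>
      if h == blank M then
        next (inl (Fill false)) false (h, MoveN)
          (stay (counter n false)) (stay (counter n true)) (hX, MoveN)
      else
        next (inl Return) false (h, MoveL)
          (stay (counter n false)) (stay (counter n true)) (hX, MoveN)
  | inl (Fill b) =>
      if f (counter n b) == blank M then
        if hX == blank M then
          next (inr (start M)) b (one, MoveN)
            (stay (counter n b)) (stay (counter n (~~ b))) (hX, MoveN)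
        else
          next (inl (Fill (~~ b))) b
            (one, MoveL) (blank M, MoveR) (one, MoveN) (hX, MoveL)
      else
        next (inl (Refill b)) b
          (one, MoveL) (blank M, MoveL) (one, MoveR) (hX, MoveN)
  | inl (Refill b) =>
      next (inl (Fill b)) b
        (h, MoveN) (stay (counter n b)) (one, MoveR) (hX, MoveN)
  | inr q =>
      let r := delta q ob [ffun i : 'I_n.+1 => f (own_tape i)] in
      (inr r.1,
       [ffun i => match split (i : 'I_(n.+1 + 3)) with
                  | inl j => r.2 j
                  | inr _ => (f i, MoveN)
                  end])
  end.

Definition padder : machine :=
  @Machine (n + 3) (pstate + state M)%type (symbol M) (blank M) (@bit M)
    (@bit_inj M) (@bit_neq_blank M) (inl (Scan ord0))
    (fun q => if q is inr q then verdict q else None)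
    (fun q => if q is inr q then query q else false)
    pdelta.

Definition inner (q : state M) (c : config padder) : config M :=
  Config q (fun i => ctapes c (own_tape i)) (cused c).

Lemma inner_step o (c : config padder) q : cstate c = inr q ->
  exists q', cstate (step o c) = inr q' /\
    step o (inner q c) = inner q' (step o c).
Proof.
case: c => Q T u /= ->; rewrite /step /=.
case: (verdict q) => [b|]; first by exists q.
set f := [ffun i => thead (T i)].
have -> : [ffun i : 'I_n.+1 => f (own_tape i)] =
    [ffun i => thead (T (own_tape i))].
  by apply/ffunP => i; rewrite !ffunE.
eexists; split; first reflexivity.
rewrite /inner /=; congr Config; apply: funext => i.
by rewrite ffunE -[X in split X]/(unsplit (inl i)) unsplitK.
Qed.

Lemma inner_iter o t (c : config padder) q : cstate c = inr q ->
  exists q', cstate (iter t (step o) c) = inr q' /\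
    iter t (step o) (inner q c) = inner q' (iter t (step o) c).
Proof.
move=> cq; elim: t => [|t [q' [cq' IH]]] /=; first by exists q.
by rewrite IH; exact: inner_step.
Qed.

(** * Length of the stretched prefix and time spent on it *)

Section PadderInvariant.
Variables (l : nat) (w : seq bool).

(** With [m] marks the rounds have lengths 1, 2, 4, ..., 2^m, in total 2^(m+1) - 1. *)
Definition pad_length := l + (2 ^ ((l + e) %/ e.+1).+1).-1.
Let P := pad_length.
Let rest := map (@bit M) (false :: w).

(** In [filling], [p] ones are present and [s + 1] more end the round. The [m] remaining rounds
    start at length [v' + v + 2 * s + 2] and double each time; summing this geometric series yields
    the equation for [P]. The equation for [k] allots two steps to each missing one. *)
Definition pinv (k : nat) (q : pstate + state M)
    (T : 'I_(n + 3).+1 -> tape (symbol M)) (u : nat) : Prop :=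
  let t0 := T (main_tape n) in
  let tX := T (extra_tape n) in
  let stacks b s v m := [/\ on_stack (blank M) (T (counter n b)) (nseq s one),
    above_stack (blank M) (T (counter n (~~ b))) (nseq v one) &
    on_stack (blank M) tX (nseq m one)] in
  let filling b v := exists p s v' m,
    [/\ t0 = Tape [::] (blank M) (nseq p one ++ rest), stacks b s v' m,
        p + s + (v' + v + 2 * s + 2) * 2 ^ m = P + (v' + v) + 2 * s + 1 &
        k + 2 * p = 2 * P + v] in
  [/\ u = 0, forall i : 'I_n.+1, i != ord0 ->
        T (own_tape i) = Tape [::] (blank M) [::] &
      match q with
      | inl (Scan i) => exists j j' m,
          [/\ l = j + j', tleft t0 = nseq j one,
              thead t0 :: tright t0 = nseq j' one ++ rest,
              [/\ on_stack (blank M) (T (counter n false)) [::],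
                  above_stack (blank M) (T (counter n true)) [::] &
                  above_stack (blank M) tX (nseq m one)] &
              j + i = e.+1 * m /\ k + l = j' + 2 + 2 * P]
      | inl Return => exists j,
          [/\ j <= l,
              t0 = Tape (behead (nseq j one)) (head (blank M) (nseq j one))
                        (nseq (l - j) one ++ rest),
              stacks false 0 0 ((l + e) %/ e.+1) & k + 2 * l = j + 1 + 2 * P]
      | inl (Fill b) => filling b 0
      | inl (Refill b) => filling b 1
      | inr q => q = start M /\
                 t0 = tape_of (blank M) (map (@bit M) (nseq P true ++ false :: w))
      end].

Lemma pinv_init :
  let c := init padder (nseq l true ++ false :: w) in
  pinv (2 * P + 2) (cstate c) (ctapes c) (cused c).
Proof.
split=> //= [i /negbTE i0|].
  by rewrite -val_eqE /= (_ : _ == _ = false).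
exists 0, l, 0; split=> //=.
- by rewrite map_cat map_nseq; case: (l).
- by split; [exists 1|exists 0|exists 0].
- by rewrite muln0; split=> //; lia.
Qed.

Lemma one_neq_blank : (one == blank M) = false.
Proof. exact/negbTE/bit_neq_blank. Qed.

Lemma zero_neq_one : (@bit M false == one) = false.
Proof. by apply/eqP => /bit_inj. Qed.

Lemma pinv_step o k q T u : pinv k (inl q) T u ->
  let c := step o (@Config padder (inl q) T u) in
  exists2 k', k' < k & pinv k' (cstate c) (ctapes c) (cused c).
Proof.
case=> -> oth inv; rewrite /step /=.
have fE i : [ffun i => thead (T i)] i = thead (T i) by rewrite ffunE.
move: [ffun i => thead (T i)] fE => f fE.
have oth' b a0 aA aB aX : forall i : 'I_n.+1, i != ord0 ->
    write_move (blank M) (act f b a0 aA aB aX (own_tape i)) (T (own_tape i)) =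
    Tape [::] (blank M) [::].
  by move=> i i0; rewrite act_other // fE write_head oth.
have lP : l <= P by exact: leq_addr.
case: q inv => [i||b|b] /= inv; rewrite ?fE.
- case: inv => j [j' [m [lE tl tr [sA sB sX] [mE kE]]]].
  case: eqP => [h0|h0] /=.
    case: j' lE tr kE => [|j'] lE [] => [h0'|_ tr kE].
      by have := zero_neq_one; rewrite -h0' h0 eqxx.
    exists k.-1; first by lia.
    split; [by []|exact: oth'|];
    exists j.+1, j', (if i == ord0 then m.+1 else m).
    rewrite !actE !write_head; split=> //=.
    + by lia.
    + by rewrite h0 tl.
    + by rewrite tr; case: (j').
    + split=> //; case: (i =P ord0) => _; last by rewrite write_head.
      exact: above_stack_push.
    + case: eqP => [i0|/eqP i0] /=; first by move: mE; rewrite i0 /=; lia.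
      have lt_i := ltn_ord i; have i_gt0 : 0 < i by rewrite lt0n.
      by rewrite inordK; lia.
  case: j' lE tr kE => [|j'] lE [] => [h0' tr kE|/h0//].
  have jE : j = l by lia.
  (* From [l + i = e.+1 * m] with [i <= e]: the number of marks is [l / e.+1] rounded up. *)
  have {}mE : (l + e) %/ e.+1 = m.
    have lt_i := ltn_ord i.
    have -> : l + e = m * e.+1 + (e - i) by lia.
    by rewrite divnMDl // divn_small ?addn0 //; lia.
  exists k.-1; first by lia.
  split; [by []|exact: oth'|];
  exists l; rewrite !actE !write_head mE; split=> //=.
  + by rewrite /write_move /= tl tr h0' jE subnn.
  + by split=> //; exact: on_stack_turn.
  + by lia.
- case: inv => j [le_j t0E [sA sB sX] kE].
  rewrite t0E; case: j le_j t0E kE => [|j] le_j t0E kE /=.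
    rewrite eqxx; exists k.-1; first by lia.
    split; [by []|exact: oth'|];
    exists l, 0, 0, ((l + e) %/ e.+1).
    rewrite !actE !write_head; split=> //.
    + by rewrite t0E /= subn0.
    + rewrite /P /pad_length; have := expn_gt0 2 ((l + e) %/ e.+1).
      by rewrite expnS; lia.
    + by lia.
  rewrite one_neq_blank; exists k.-1; first by lia.
  split; [by []|exact: oth'|];
  exists j; rewrite !actE !write_head t0E; split=> //=.
  + by lia.
  + by rewrite /write_move /= subnS; have -> : l - j = (l - j).-1.+1 by lia.
  + by lia.
- case: inv => p [s [v [m [t0E [sA sB sX] pE kE]]]].
  have m_gt0 : 0 < 2 ^ m by rewrite expn_gt0.
  (* Bounding [2 ^ m] below by 1 in [pE] leaves [p + s + 1 <= P], so [k] is still positive. *)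
  have pP : p < P by have := leq_pmulr (v + 0 + 2 * s + 2) m_gt0; lia.
  case: s sA pE {m_gt0} => [|s] sA pE.
    rewrite (on_stack_nil sA) eqxx /=; case: m sX pE => [|m] sX pE.
      rewrite (on_stack_nil sX) eqxx /=; exists 0.
        by lia.
      split; [by []|exact: oth'|];
      split=> //; rewrite actE t0E /write_move /= -/P.
      have -> : P = p.+1 by lia.
      by rewrite /= map_cat map_nseq.
    rewrite (on_stack_cons sX) one_neq_blank /=; exists (k - 2); first by lia.
    split; [by []|exact: oth'|];
    exists p.+1, v.+1, 0, m; rewrite negbK !actE; split=> //=.
    + by rewrite t0E.
    + split; [exact: on_stack_push sB|exact: above_stack_turn sA|].
      exact: on_stack_pop sX.
    + by move: pE; rewrite expnS; lia.
    + by lia.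
  rewrite (on_stack_cons sA) one_neq_blank /=; exists k.-1; first by lia.
  split; [by []|exact: oth'|];
  exists p.+1, s, v.+1, m; rewrite !actE write_head; split=> //=.
  + by rewrite t0E.
  + by split=> //; [exact: on_stack_pop sA|exact: above_stack_push sB].
  + have -> : v.+1 + 1 + 2 * s + 2 = v + 0 + 2 * s.+1 + 2 by lia.
    by lia.
  + by lia.
- case: inv => p [s [v [m [t0E [sA sB sX] pE kE]]]].
  exists k.-1; first by lia.
  split; [by []|exact: oth'|];
  exists p, s, v.+1, m.
  rewrite !actE !write_head; split=> //.
  + by split=> //; exact: above_stack_push.
  + by rewrite addn0 -(addn1 v).
  + by lia.
Qed.

Lemma padder_init o : let y := nseq P true ++ false :: w in
  exists t q, [/\ t <= 2 * P + 2,
    cstate (run padder o (nseq l true ++ false :: w) t) = inr q &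
    inner q (run padder o (nseq l true ++ false :: w) t) = init M y].
Proof.
move=> y.
pose I k (c : config padder) := pinv k (cstate c) (ctapes c) (cused c).
pose D (c : config padder) := exists2 q, cstate c = inr q & inner q c = init M y.
have [k c|t le_t [q cq qE]] := @reach padder o I D _ _ _ pinv_init; last first.
  by exists t, q.
case: c => -[q|q] T u; rewrite /I /D; first by right; exact: pinv_step.
case=> /= -> oth [-> t0E]; left; exists (start M) => //.
rewrite /inner /init /=; congr Config; apply: funext => i.
by case: eqP => [->|/eqP /oth //]; rewrite -t0E; congr T; exact: val_inj.
Qed.


End PadderInvariant.
End Padder.

(** * The reduction *)

(** Stretching takes at most [2 * pad_length e l + 2] steps, uses no oracle bit and ends in the
    exact initial configuration of [M] on [y]; surplus steps change nothing once [M] has halted. *)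
Lemma padder_run e M l w o tM :
  let y := nseq (pad_length e l) true ++ false :: w in
  let c := run (padder e M) o (nseq l true ++ false :: w)
             (2 * pad_length e l + 2 + tM) in
  verdict (cstate (run M o y tM)) ->
  verdict (cstate c) = verdict (cstate (run M o y tM)) /\
  cused c = cused (run M o y tM).
Proof.
move=> y c haltM.
have [t [q [le_t cq qE]]] := @padder_init e M l w o.
have [q' [cq' qE']] := inner_iter o (2 * pad_length e l + 2 + tM - t) cq.
move: cq' qE'; rewrite qE -iterD subnK; last first.
  by apply: leq_trans le_t _; exact: leq_addr.
have le_tM : tM <= 2 * pad_length e l + 2 + tM - t by lia.
rewrite -/c (halted_leq le_tM haltM).
by move=> cq' qE'; rewrite /run qE' /= cq'.
Qed.

(** The stretched prefix has length at least [2 ^ m] with [m] at least [l / e.+1], so [e.+1] bits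
    per round cover all [l] variables. *)
Lemma pad_length_rounds e l : l <= e.+1 * trunc_log 2 (pad_length e l).
Proof.
set m := (l + e) %/ e.+1.
have le_m : l <= e.+1 * m.
  have := divn_eq (l + e) e.+1; have := ltn_pmod (l + e) (ltn0Sn e).
  by rewrite -/m; lia.
apply: leq_trans le_m _; rewrite leq_mul2l; apply: trunc_log_max => //.
have m_gt0 : 0 < 2 ^ m by rewrite expn_gt0.
by rewrite /pad_length -/m expnS; lia.
Qed.

Lemma pad_length_gt0 e l : 0 < pad_length e l.
Proof.
have : 0 < 2 ^ ((l + e) %/ e.+1) by rewrite expn_gt0.
by rewrite /pad_length expnS; lia.
Qed.

Lemma size_flatten_map_leq (T1 T2 : eqType) (f : T1 -> seq T2) s b :
  (forall x, size (f x) <= b) -> size (flatten (map f s)) <= size s * b.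
Proof.
by move=> fb; elim: s => //= x s IH; rewrite size_cat mulSn leq_add.
Qed.

(** There are at most [(2 * l) ^ 3] distinct clauses of three literals, and a literal takes a sign,
    fewer than [l] ones and a final zero. *)
Lemma size_encode_clauses l (phi : cnf3 l) : uniq phi ->
  size (encode_clauses phi) <= 24 * l ^ 3 * l.+1.
Proof.
move=> phi_uniq; apply: (@leq_trans (size phi * (3 * l.+1))).
  apply: size_flatten_map_leq => c; rewrite -[X in _ <= X * _](size_tuple c).
  apply: size_flatten_map_leq => -[b v].
  by rewrite /= size_rcons size_nseq ltnS.
have : size phi <= (2 * l) ^ 3.
  rewrite -(card_uniqP phi_uniq) (leq_trans (max_card _)) //.
  by rewrite card_tuple card_prod card_bool card_ord.
move=> /leq_mul/(_ (leqnn (3 * l.+1)))/leq_trans; apply.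
by rewrite expnMn (_ : 2 ^ 3 = 8) //; lia.
Qed.

(** The finitely many exceptional lengths are absorbed into [K]. *)
Lemma bigO_id_bound T : is_bigO T id -> exists C K, forall n, T n <= C * n + K.
Proof.
case=> C [N TO]; exists C, (\max_(i < N) T i) => n.
case: (leqP N n) => [/TO le_T|lt_n].
  exact: leq_trans le_T (leq_addr _ _).
exact: leq_trans (leq_bigmax (Ordinal lt_n)) (leq_addl _ _).
Qed.

Import Order.TTheory GRing.Theory Num.Theory.
Local Open Scope classical_set_scope.
Local Open Scope ring_scope.

Lemma mul_trunc_log_le_ceil_klog2 (R : realType) (d n : nat) :
  (d * trunc_log 2 n <= @ceil_klog2 R d%:R n)%N.
Proof.
case: n => [|n]; first by rewrite trunc_log0 ?muln0.
set r := trunc_log 2 n.+1; rewrite /ceil_klog2; set x := d%:R * _.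
have ln2_gt0 : 0 < ln (2 : R) by rewrite ln_gt0 // ltr1n.
have le_x : ((d * r)%N%:R <= x :> R).
  rewrite /x natrM ler_wpM2l // ler_pdivlMr // mulr_natl -lnXn //.
  rewrite ler_ln ?posrE ?exprn_gt0 ?ltr0n // -natrX ler_nat.
  exact: trunc_logP.
have : ((d * r)%N : int) <= Num.ceil x.
  by rewrite -(ler_int R) (le_trans le_x) // Num.Theory.ceil_ge.
by lia.
Qed.

(** Since [e.+1] is at least [1 / c], the number of marks is at most [c * l + 1]. One factor 2 comes
    from this rounding, the other from the final round. *)
Lemma expn_pad_le (R : realType) (c : R) (e l : nat) :
  c^-1 <= e.+1%:R -> 0 < c ->
  (2 ^ ((l + e) %/ e.+1).+1)%:R <= 4 * 2 `^ (c * l%:R) :> R.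
Proof.
move=> le_e c_gt0; set m := (_ %/ _)%N.
have le_m : (m * e.+1 <= l + e)%N by exact: leq_divM.
have d_gt0 : 0 < e.+1%:R :> R by rewrite ltr0n.
have le_mr : m%:R <= c * l%:R + 1 :> R.
  have le_md : m%:R * e.+1%:R <= l%:R + e%:R :> R.
    by rewrite -natrM -natrD ler_nat.
  have le1 : 1 <= c * e.+1%:R.
    by rewrite -(ler_pM2l c_gt0) in le_e; rewrite mulfV ?gt_eqF in le_e.
  rewrite -(ler_pM2r d_gt0) (le_trans le_md) //.
  rewrite mulrDl mul1r -[e.+1%:R in X in _ <= _ + X]natr1.
  have : l%:R * 1 <= l%:R * (c * e.+1%:R) by rewrite ler_wpM2l.
  by lra.
have : 2 `^ m%:R <= 2 `^ (c * l%:R + 1) :> R by rewrite ler_powR // ler1n.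
rewrite powRD ?pnatr_eq0 ?implybT // powRr1 // powR_mulrn //.
by rewrite expnS natrM natrX; lra.
Qed.

Theorem theorem6 (R : realType) :
  ETH R ->
  exists2 k : R, 0 < k &
    ~ (NDTIME (ceil_klog2 k) (fun n => n) `<=` DTIME (fun n => n)).
Proof.
case=> c c_gt0 not_fast.
pose e := Num.bound c^-1; have le_e : c^-1 <= e.+1%:R.
  apply/ltW/(lt_trans (archi_boundP _)); first by rewrite invr_ge0 ltW.
  by rewrite ltr_nat.
exists e.+1%:R => [|sub_DTIME]; first by rewrite ltr0n.
pose G := guesser e.+1; pose TG n := ((3 * e.+1 + 5) * n + 1)%N.
pose L : set (seq bool) := [set x | accepts_within G x (TG (size x))].
have /sub_DTIME[M [T [/bigO_id_bound[C [K TE]] MT]]] :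
    NDTIME (ceil_klog2 (e.+1%:R : R)) (fun n => n) L.
  exists G, TG; split=> [|x].
    by exists (3 * e.+1 + 6)%N, 1%N => n; rewrite /TG; lia.
  split=> // o; have [b [hb ub _]] := guesser_run e.+1 x o.
  rewrite /TG hb; split=> //; apply: leq_trans ub _.
  exact: mul_trunc_log_le_ceil_klog2.
case: not_fast; exists (padder e M).
(* With [P] the stretched length, the time is at most [(C + 2) * P.+1 + C * size w + K]; here [P.+1]
   is at most [l] plus 4 times the exponential, and [size w] at most [24 * l ^ 3 * l.+1]. *)
exists ((C + 2)%:R *: ('X + 4%:P) +
        C%:R *: (24 *: ('X^3 * ('X + 1%:P))) + K%:R%:P).
move=> l phi phi_uniq.
have -> : encode_cnf3 phi = nseq l true ++ false :: encode_clauses phi.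
  by rewrite /encode_cnf3 cat_rcons.
set w := encode_clauses phi; pose y := nseq (pad_length e l) true ++ false :: w.
have runE o := @padder_run e M l w o (T (size y)) ((MT y).1 o).1.
exists (2 * pad_length e l + 2 + T (size y))%N; split.
- set E := 2 `^ _.
  rewrite !(hornerXn, hornerD, hornerZ, hornerM, hornerX, hornerC).
  rewrite [24 * (_ * _)]mulrA.
  have E_ge1 : 1 <= E.
    rewrite -(powRr0 2) ler_powR ?ler1n // mulr_ge0 // ltW //.
  have PE : (pad_length e l).+1%:R <= l%:R + 4 * E.
    apply: le_trans (lerD (lexx _) (expn_pad_le l le_e c_gt0)).
    rewrite -natrD ler_nat /pad_length -addnS prednK //.
    by rewrite expn_gt0.
  have wE : (size w)%:R <= 24 * l%:R ^+ 3 * (l%:R + 1) :> R.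
    rewrite natr1 -natrX -!natrM ler_nat; exact: size_encode_clauses.
  have tE : (2 * pad_length e l + 2 + T (size y) <=
      (C + 2) * (pad_length e l).+1 + C * size w + K)%N.
    have := TE (size y); rewrite /y size_cat size_nseq /= -/w; lia.
  apply: le_trans
    (_ : _ <= ((C + 2) * (pad_length e l).+1 + C * size w + K)%N%:R) _.
    by rewrite ler_nat.
  rewrite !natrD !natrM; move: wE; set W := 24 * _ * _ => wE.
  have W_ge0 : 0 <= W by exact: le_trans wE.
  have := ler_wpM2l (ler0n R (C + 2)) PE; have := ler_wpM2l (ler0n R C) wE.
  (* Terms lacking the factor [E] may be multiplied by it, as [E] is at least 1. *)
  have : 0 <= ((C + 2)%:R * l%:R + C%:R * W + K%:R) * (E - 1).
    by rewrite mulr_ge0 ?subr_ge0 // !addr_ge0 // mulr_ge0.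
  rewrite -/W natrD; clearbody W; lra.
- move=> o; have [-> ->] := runE o; exact: (MT y).1.
- have sat := @satisfiableP l phi _ (pad_length_rounds e l).
  have accM : accepts_within M y (T (size y)) <-> accepts_within (padder e M)
      (nseq l true ++ false :: w) (2 * pad_length e l + 2 + T (size y)).
    by split=> -[o acc]; exists o; move: acc; have [-> _] := runE o.
  (* Membership of [y] in [L] is acceptance by [G], whose verdict under [o] is the evaluation of the
     clauses on the bits of [o]; the same [o] serves in both directions. *)
  rewrite -accM -(MT y).2 sat; split=> -[o].
    have [b [hb _ bE]] := guesser_run e.+1 y o => acc; exists o.
    by rewrite /G /TG hb (bE _ _ (pad_length_gt0 e l) erefl); congr Some.
  have [b [hb _ bE]] := guesser_run e.+1 y o => acc; exists o.
  by move: acc; rewrite /G /TG hb (bE _ _ (pad_length_gt0 e l) erefl) => -[].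
Qed.
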